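(* The function $f=(f_1,f_2,f_3):D^{J+K}\to D^{2J+K}$ defined in the context is continuous when both the domain and the range are endowed with the Skorokhod $J_1$ topology.
   Context: $[k]=\{1,\dots,k\}$. $D^k$ is the set of functions $[0,\infty)\to\mathbb{R}^k$ that are right continuous on $[0,\infty)$ with left limits on $(0,\infty)$; $D=D^1$. Skorokhod $J_1$ convergence $x^n\to x$ in $D^k$ means: for all continuity points $T>0$ of $x$, $d_T^k(x^n|_{[0,T]},x|_{[0,T]})\to0$, where $d_T^k(x,y)=\inf_{\lambda}\{\|x\circ\lambda-y\|_{T,k}\vee\sup_{t\in[0,T]}|\lambda(t)-t|\}$, the infimum is over increasing homeomorphisms $\lambda$ of $[0,T]$, and $\|x\|_{T,k}=\max_{l\in[k]}\sup_{t\in[0,T]}|x_l(t)|$. Fixed data: $J,K\in\mathbb{N}$, $\mu_j>0$ ($j\in[J]$), $\eta_k>0$ ($k\in[K]$), and stochastic matrices $(p_{jk})\in\mathbb{R}^{J\times K}$, $(q_{kj})\in\mathbb{R}^{K\times J}$ (nonnegative entries, rows summing to $1$). For $x\in D$: $\psi(x)(t)=\sup_{0\le s\le t}[-x(s)]^+$ and $\phi(x)(t)=x(t)+\psi(x)(t)$. For $(\xi,\zeta)\in D^{J+K}$ ($\xi\in D^J$, $\zeta\in D^K$), $f_3(\xi,\zeta)$ is the unique $y\in D^K$ satisfying, for all $k\in[K]$, $t\ge0$, $$y_k(t)=\zeta_k(t)-\eta_k\int_0^ty_k(s)\,ds-\sum_{j=1}^Jp_{jk}\,\psi\Big(\xi_j+\sum_{l=1}^Kq_{lj}\eta_l\int_0^{\cdot}y_l(s)\,ds\Big)(t)$$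 (existence and uniqueness of such $y$ hold for every $(\xi,\zeta)\in D^{J+K}$). With $y=f_3(\xi,\zeta)$, the maps $f_1,f_2:D^{J+K}\to D^J$ are $$f_1(\xi,\zeta)=\Big(\phi\big(\xi_j+\sum_{l=1}^Kq_{lj}\eta_l\int_0^{\cdot}y_l(s)\,ds\big)\Big)_{j\in[J]},\qquad f_2(\xi,\zeta)=\Big(\mu_j^{-1}\psi\big(\xi_j+\sum_{l=1}^Kq_{lj}\eta_l\int_0^{\cdot}y_l(s)\,ds\big)\Big)_{j\in[J]}.$$ *)

(* Defs.v *)
From HB Require Import structures.
From mathcomp Require Import all_boot all_order all_algebra.
From mathcomp Require Import all_classical all_reals all_analysis.

Set Implicit Arguments.
Unset Strict Implicit.
Unset Printing Implicit Defensive.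

Import Order.TTheory GRing.Theory Num.Theory.
Import numFieldNormedType.Exports.

Local Open Scope classical_set_scope.
Local Open Scope ring_scope.

(* A path [0, oo) -> R^k is represented by a total function R -> 'rV[R]_k.
   Every notion below depends only on the values at nonnegative times; the
   values at negative times are irrelevant. *)

Definition cadlag (R : realType) (k : nat) (x : R -> 'rV[R]_k) : Prop :=
  (forall t : R, 0 <= t -> x @ t^'+ --> x t) /\
  (forall t : R, 0 < t -> exists l : 'rV[R]_k, x @ t^'- --> l).

Definition incr_homeo (R : realType) (T : R) (lam : R -> R) : Prop :=
  [/\ {in `[0, T] &, {homo lam : s t / s < t}},
      {within `[0, T], continuous lam} &
      exists lam' : R -> R,
        [/\ set_fun `[0, T] `[0, T] lam, set_fun `[0, T] `[0, T] lam',
            {in `[0, T], cancel lam lam'}, {in `[0, T], cancel lam' lam} &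
            {within `[0, T], continuous lam'}]].

(* Suprema and infima are taken in the extended reals, so that no boundedness
   or nonemptiness side condition is needed. *)
Definition unorm (R : realType) (k : nat) (T : R) (x : R -> 'rV[R]_k) : \bar R :=
  \big[maxe/0%E]_(l < k)
    ereal_sup [set (`|x t ord0 l|)%:E | t in `[0, T]].

Definition J1_dist (R : realType) (k : nat) (T : R) (x y : R -> 'rV[R]_k) :
    \bar R :=
  ereal_inf
    [set maxe (unorm T (fun t => x (lam t) - y t))
              (ereal_sup [set (`|lam t - t|)%:E | t in `[0, T]])
      | lam in [set lam | incr_homeo T lam]].

Definition J1_cvg (R : realType) (k : nat)
    (u : nat -> R -> 'rV[R]_k) (x : R -> 'rV[R]_k) : Prop :=
  forall T : R, 0 < T -> {for T, continuous x} ->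
    J1_dist T (u n) x @[n --> \oo] --> 0%E.

(* F maps D^m to D^n and is continuous for the J_1 topologies.  These topologies
   are metrizable and are specified through their convergent sequences. *)
Definition J1_continuous (R : realType) (m n : nat)
    (F : (R -> 'rV[R]_m) -> (R -> 'rV[R]_n)) : Prop :=
  (forall x, cadlag x -> cadlag (F x)) /\
  (forall (u : nat -> R -> 'rV[R]_m) (x : R -> 'rV[R]_m),
     (forall i, cadlag (u i)) -> cadlag x ->
     J1_cvg u x -> J1_cvg (fun i => F (u i)) (F x)).

Definition stochastic (R : realType) (m n : nat) (A : 'M[R]_(m, n)) : Prop :=
  (forall i j, 0 <= A i j) /\ (forall i, \sum_j A i j = 1).

Definition psi (R : realType) (x : R -> R) (t : R) : R :=
  sup [set Num.max (- x s) 0 | s in `[0, t]].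

Definition phi (R : realType) (x : R -> R) (t : R) : R := x t + psi x t.

(* xi_j + \sum_l q_lj eta_l \int_0^. y_l(s) ds *)
Definition net_input (R : realType) (J K : nat) (eta : 'I_K -> R)
    (q : 'M[R]_(K, J)) (xi : R -> 'rV[R]_J) (y : R -> 'rV[R]_K) (j : 'I_J) :
    R -> R :=
  fun t => xi t ord0 j +
    \sum_(l < K) q l j * eta l *
      \int[lebesgue_measure]_(s in `[0, t]) y s ord0 l.

Definition is_solution (R : realType) (J K : nat) (eta : 'I_K -> R)
    (p : 'M[R]_(J, K)) (q : 'M[R]_(K, J))
    (xi : R -> 'rV[R]_J) (zeta : R -> 'rV[R]_K) (y : R -> 'rV[R]_K) : Prop :=
  cadlag y /\
  forall (k : 'I_K) (t : R), 0 <= t ->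
    y t ord0 k = zeta t ord0 k
      - eta k * \int[lebesgue_measure]_(s in `[0, t]) y s ord0 k
      - \sum_(j < J) p j k * psi (net_input eta q xi y j) t.

(* In f1, f2, f3 and f, the argument x : R -> 'rV_(J + K) is the pair
   (xi, zeta) = (lsubmx \o x, rsubmx \o x). *)

(* The solution is unique on [0, oo); [get] selects one total function
   representing it. *)
Definition f3 (R : realType) (J K : nat) (eta : 'I_K -> R)
    (p : 'M[R]_(J, K)) (q : 'M[R]_(K, J)) (x : R -> 'rV[R]_(J + K)) :
    R -> 'rV[R]_K :=
  get [set y | is_solution eta p q
                 (fun t => lsubmx (x t)) (fun t => rsubmx (x t)) y].

Definition f1 (R : realType) (J K : nat) (eta : 'I_K -> R)
    (p : 'M[R]_(J, K)) (q : 'M[R]_(K, J)) (x : R -> 'rV[R]_(J + K)) :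
    R -> 'rV[R]_J :=
  fun t => \row_j
    phi (net_input eta q (fun s => lsubmx (x s)) (f3 eta p q x) j) t.

Definition f2 (R : realType) (J K : nat) (mu : 'I_J -> R) (eta : 'I_K -> R)
    (p : 'M[R]_(J, K)) (q : 'M[R]_(K, J)) (x : R -> 'rV[R]_(J + K)) :
    R -> 'rV[R]_J :=
  fun t => \row_j
    ((mu j)^-1 *
       psi (net_input eta q (fun s => lsubmx (x s)) (f3 eta p q x) j) t).

Definition f (R : realType) (J K : nat) (mu : 'I_J -> R) (eta : 'I_K -> R)
    (p : 'M[R]_(J, K)) (q : 'M[R]_(K, J)) (x : R -> 'rV[R]_(J + K)) :
    R -> 'rV[R]_(J + J + K) :=
  fun t => row_mx (row_mx (f1 eta p q x t) (f2 mu eta p q x t)) (f3 eta p q x t).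

(* Main.v *)
Require Import Defs.
From HB Require Import structures.
From mathcomp Require Import all_boot all_order all_algebra.
From mathcomp Require Import all_classical all_reals all_analysis.
From mathcomp Require Import ring lra.
Import Order.TTheory GRing.Theory Num.Theory.
Import numFieldNormedType.Exports.
Local Open Scope classical_set_scope.
Local Open Scope ring_scope.

Set Implicit Arguments.
Unset Strict Implicit.
Unset Printing Implicit Defensive.

(** The third component [y] of the map is a fixed point of an operator that sees
    its argument only through the integrals of [y], composed with the reflection
    map [psi], which is 1-Lipschitz for the uniform norm and commutes with changes
    of time.

    Suppose that [x'], read along a change of time [lam] of [[0, T]], is within
    [rho] of [x], and let [y'], [y] be the corresponding fixed points.  If
    [y' \o lam] and [y] differ at time [t] by at most [N * expR (A * t)], then so
    do the integrals of [y'] up to [lam t] and of [y] up to [t] by about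
    [N * A^-1 * expR (A * t)], plus the error made by comparing the integral of
    [y \o lam^-1] up to [lam t] with that of [y] up to [t].  This last error
    concerns a single path: approximating [y] by a step function shows that it
    tends to 0 as [lam] tends to the identity ([integral_time_change]).  Choosing
    [A] large, one application of the operator halves [N] up to a multiple of
    [rho] ([picard_close]).

    Three consequences follow.  With [lam] the identity, the estimate is that of
    a contraction, so the fixed point exists on the whole half line
    ([picard_fixpoint]) and the chosen solution is a genuine one.  In general,
    since two solutions are both fixed, their distance along [lam] is bounded by a
    multiple of [rho] ([fixpoint_close]).  The same holds for the net inputs,
    hence for all components of the map, with the same [lam] ([f_close]), which is
    convergence for the J1 topology on [[0, T]].

    It remains to match the horizons: convergence of the images is asked for at
    continuity points [T] of the image of [x], and convergence of the arguments is
    given at those of [x].  As [phi - psi] is the net input, no jump of [x]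
    disappears from its image ([f_continuity_point]). *)

(** * Right-continuous paths with left limits, and step approximation *)
Section Regulated.
Context {R : realType}.
Implicit Types (g h : R -> R) (a b c d e s t r : R).

(** Cauchy form of a one-point regularity property.  Choosing the relation [E]
    gives two notions at once: with [same_side t] it is right continuity at [t]
    together with a left limit, with the full relation it is continuity at [t].
    The closure lemmas below then serve for both. *)
Definition osc (E : rel R) t g : Prop :=
  forall e, 0 < e -> exists2 d, 0 < d &
    forall s r, 0 <= s -> 0 <= r -> `|s - t| < d -> `|r - t| < d -> E s r ->
      `|g s - g r| <= e.

Definition same_side t : rel R := fun s r => (s < t) == (r < t).

(** The time [t] itself counts as lying on its right side, which is what makes
    the right limit equal to the value; at [t = 0] the left side is empty since
    [osc] only looks at nonnegative times. *)
Definition rcll g : Prop := forall t, 0 <= t -> osc (same_side t) t g.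

Lemma osc_cst E t c : osc E t (fun=> c).
Proof. by move=> e e0; exists 1 => // *; rewrite subrr normr0 ltW. Qed.

Lemma oscD E t g h : osc E t g -> osc E t h -> osc E t (fun s => g s + h s).
Proof.
move=> og oh e e0; have e20 : 0 < e / 2 by rewrite divr_gt0.
have [d d0 gd] := og _ e20; have [d' d'0 hd] := oh _ e20.
exists (Num.min d d') => [|s r s0 r0]; first by rewrite lt_min d0.
rewrite !lt_min => /andP[sd sd'] /andP[rd rd'] Esr.
have := gd s r s0 r0 sd rd Esr; have := hd s r s0 r0 sd' rd' Esr.
rewrite !ler_norml; lra.
Qed.

Lemma oscZ E t g c : osc E t g -> osc E t (fun s => c * g s).
Proof.
move=> og e e0; have c0 : 0 < `|c| + 1 by rewrite ltr_wpDl.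
have [d d0 gd] := og _ (divr_gt0 e0 c0); exists d => // s r s0 r0 sd rd Esr.
rewrite -mulrBr normrM.
apply: (@le_trans _ _ ((`|c| + 1) * `|g s - g r|)).
  by rewrite ler_wpM2r// lerDl.
by rewrite mulrC -ler_pdivlMr//; exact: gd.
Qed.

Lemma osc_sum (I : Type) (l : seq I) E t (G : I -> R -> R) :
  (forall i, osc E t (G i)) -> osc E t (fun s => \sum_(i <- l) G i s).
Proof.
move=> oG; elim: l => [|i l ih].
  rewrite (_ : (fun s => _) = fun=> 0); first exact: osc_cst.
  by apply/funext => s; rewrite big_nil.
rewrite (_ : (fun s => _) = fun s => G i s + \sum_(i <- l) G i s).
  exact: oscD.
by apply/funext => s; rewrite big_cons.
Qed.

Lemma osc_ext E t g h : {in Num.nneg, g =1 h} -> osc E t g -> osc E t h.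
Proof.
move=> gh og e e0; have [d d0 gd] := og _ e0; exists d => // s r s0 r0 sd rd Esr.
by rewrite -!gh; [exact: gd| |].
Qed.

(** Compactness of a segment in the form of an induction principle: the
    supremum of the points reachable from [a] is itself reachable, by the local
    hypothesis on its left, and cannot lie before [b], by the local hypothesis on
    its right.  Only intervals on one side of [t] are required locally, because
    a path may jump at [t]. *)
Lemma segment_ind (P : R -> R -> Prop) :
  (forall a b c, P a b -> P b c -> P a c) ->
  (forall t, 0 <= t -> exists2 d, 0 < d & forall a b, 0 <= a -> a <= b ->
     `|a - t| < d -> `|b - t| < d -> b <= t \/ t <= a -> P a b) ->
  forall a b, 0 <= a -> a <= b -> P a b.
Proof.
move=> Pcat Ploc a b a0 ab.
have [da da0 Pa] := Ploc _ a0.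
pose S := [set t | a <= t <= b /\ P a t].
have Sa : S a.
  by split; [rewrite lexx|apply: Pa; rewrite ?subrr ?normr0//; left].
have hS : has_sup S by split; [exists a|exists b => t [/andP[]]].
have aS : a <= sup S by apply: ub_le_sup => //; exact: hS.2.
have Sb : sup S <= b by apply: ge_sup; [exists a|move=> t [/andP[]]].
have [d d0 Pd] := Ploc _ (le_trans a0 aS).
have [t [/andP[at_ tb] Pt] td] := sup_adherent d0 hS.
have tS : t <= sup S by apply: ub_le_sup; [exact: hS.2|split=> //; apply/andP].
have Ps : P a (sup S).
  apply: (Pcat _ _ _ Pt); apply: Pd => //; rewrite ?subrr ?normr0//.
  - exact: le_trans at_.
  - by rewrite ltr_norml; apply/andP; split; lra.
  - by left.
pose b' := Num.min b (sup S + d / 2).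
have Sb' : sup S <= b' by rewrite le_min Sb lerDl ltW// divr_gt0.
have b'd : b' <= sup S + d / 2 by rewrite ge_min lexx orbT.
have Pb' : P a b'.
  apply: (Pcat _ _ _ Ps); apply: Pd => //; rewrite ?subrr ?normr0//.
  - exact: le_trans aS.
  - by rewrite ltr_norml; apply/andP; split; lra.
  - by right.
have : b' <= sup S.
  apply: ub_le_sup; first exact: hS.2.
  by split=> //; rewrite (le_trans aS Sb')/= ge_min lexx.
rewrite ge_min => /orP[bS|]; last by lra.
by move: Pb'; rewrite /b'; have -> : Num.min b (sup S + d / 2) = b
  by apply/min_idPl; lra.
Qed.

(** Uniform approximation by a step function.  Pieces are half open, so that a
    jump may take place at the right end of each.  An inductive predicate, rather
    than a list of breakpoints, lets one transport an approximation through a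
    change of time or accumulate an estimate over its pieces by induction. *)
Inductive step_approx e g : R -> R -> Prop :=
| flat_piece a b c : a <= b -> (forall s, a <= s < b -> `|g s - c| <= e) ->
    step_approx e g a b
| cat_pieces a b c : step_approx e g a b -> step_approx e g b c ->
    step_approx e g a c.

Definition regulated g a b := forall e, 0 < e -> step_approx e g a b.

Lemma step_approx_le e g a b : step_approx e g a b -> a <= b.
Proof. by elim=> // a' b' c _ ab _; exact: le_trans. Qed.

Lemma rcll_regulated g a b : rcll g -> 0 <= a -> a <= b -> regulated g a b.
Proof.
move=> rg a0 ab e e0; move: a b a0 ab; apply: segment_ind => [|t t0].
  by move=> a b c; exact: cat_pieces.
have [d d0 gd] := rg t t0 _ e0; exists d => // a b a0 ab.
move=> /ltr_normlP[ad1 ad2] /ltr_normlP[bd1 bd2] sd.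
apply: (@flat_piece _ _ _ _ (g a)) => // s /andP[as_ sb].
apply: gd => //; first exact: le_trans as_.
- by apply/ltr_normlP; split; lra.
- exact/ltr_normlP.
rewrite /same_side; case: sd => [bt|ta].
  by rewrite (lt_le_trans sb bt) (le_lt_trans as_ (lt_le_trans sb bt)).
by rewrite !ltNge (le_trans ta as_) ta.
Qed.

Lemma step_approx_bounded e g a b : step_approx e g a b ->
  exists M, forall s, a <= s < b -> `|g s| <= M.
Proof.
elim=> [{}a {}b c ab gc|{}a {}b c _ [M1 h1] _ [M2 h2]].
  exists (`|c| + e) => s /gc h; rewrite -[g s](subrK c) addrC.
  by rewrite (le_trans (ler_normD _ _))// lerD2l.
exists (Num.max M1 M2) => s /andP[as_ sc]; rewrite le_max.
have [sb|bs] := ltP s b; first by rewrite h1// as_.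
by rewrite (h2 s) ?orbT// bs.
Qed.

Lemma regulated_bounded g a b : regulated g a b ->
  exists M, forall s, a <= s <= b -> `|g s| <= M.
Proof.
move=> /(_ 1 ltr01)/step_approx_bounded[M h].
exists (Num.max M `|g b|) => s /andP[as_]; rewrite le_eqVlt le_max.
by move=> /orP[/eqP->|sb]; rewrite ?lexx ?orbT// h// as_.
Qed.

Lemma step_approx_measurable e g a b : step_approx e g a b ->
  exists2 h : R -> R, measurable_fun setT h &
    forall s, a <= s < b -> `|g s - h s| <= e.
Proof.
elim=> [{}a {}b c ab gc|{}a {}b c _ [h1 m1 gh1] _ [h2 m2 gh2]].
  by exists (fun=> c).
exists (fun s => if s < b then h1 s else h2 s).
  apply: measurable_fun_ifT => //.
  exact: measurable_realfun.measurable_fun_ltr.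
move=> s /andP[as_ sc]; have [sb|bs] := ltP s b.
  by rewrite gh1// as_.
by rewrite gh2// bs.
Qed.

(** A pointwise limit of measurable step approximations is measurable, and a
    regulated function is bounded; changing the value at [b] affects neither. *)
Lemma regulated_integrable g a b : regulated g a b ->
  lebesgue_measure.-integrable `[a, b] (EFin \o g).
Proof.
move=> rg; apply: measurable_bounded_integrable => //.
- by rewrite /= lebesgue_measure_itv/=; case: ifP => // _; rewrite -EFinB ltry.
- apply/measurable_realfun.measurable_fun_itv_bndo_bndcP.
  have hn n : {h : R -> R | measurable_fun setT h /\
      forall s, a <= s < b -> `|g s - h s| <= n.+1%:R^-1}.
    apply/cid; have n0 : 0 < n.+1%:R^-1 :> R by rewrite invr_gt0.
    by have [h mh gh] := step_approx_measurable (rg _ n0); exists h.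
  apply: (@measurable_realfun.measurable_fun_cvg _ _ _ _ (fun n => sval (hn n))).
    by move=> n; apply: measurable_funS (svalP (hn n)).1.
  move=> s; rewrite /= in_itv/= => sab; apply/cvgrPdist_le => e e0; near=> n.
  apply: (le_trans ((svalP (hn n)).2 s sab)); apply: ltW.
  by near: n; exact: near_infty_natSinv_lt (PosNum e0).
- have [M gM] := regulated_bounded rg.
  exists M; split; first exact: num_real.
  move=> M' MM' s /=; rewrite in_itv/= => /gM h.
  exact: le_trans (ltW MM').
Unshelve. all: by end_near. Qed.

End Regulated.

Notation segment_integral g a b := (\int[lebesgue_measure]_(s in `[a, b]) g s).

(** * Integrals of nearly constant and of exponentially bounded functions *)
Section Integral.
Context {R : realType}.
Implicit Types (g h : R -> R) (a b c d e s t r : R).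

Local Notation mu := (@lebesgue_measure R).

Lemma integrable_sub g a b a' b' : mu.-integrable `[a, b] (EFin \o g) ->
  a <= a' -> b' <= b -> mu.-integrable `[a', b'] (EFin \o g).
Proof.
move=> ig aa bb; apply: integrableS ig => // s /=.
by rewrite !in_itv/= => /andP[? ?]; apply/andP; split; lra.
Qed.

Lemma integral_cat g a b c : mu.-integrable `[a, c] (EFin \o g) ->
  a <= b -> b <= c ->
  segment_integral g a c = segment_integral g a b + segment_integral g b c.
Proof.
move=> ig ab bc; apply/eqP; rewrite addrC -subr_eq; apply/eqP.
rewrite Rintegral_itvB ?bnd_simp// Rintegral_itv_obnd_cbnd//.
apply: integrableS ig => // s /=; rewrite !in_itv/= => /andP[? ->].
by rewrite andbT; lra.
Qed.

Lemma integral_near_cst g a b c e : mu.-integrable `[a, b] (EFin \o g) ->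
  a <= b -> (forall s, a <= s < b -> `|g s - c| <= e) ->
  `|segment_integral g a b - c * (b - a)| <= e * (b - a).
Proof.
move=> ig ab gc.
have ig' : mu.-integrable `[a, b[ (EFin \o g).
  apply: integrableS ig => // s /=; rewrite !in_itv/= => /andP[-> ?].
  exact: ltW.
have ic r : mu.-integrable `[a, b[ (EFin \o cst r).
  apply: measurable_bounded_integrable => //.
    by rewrite /= lebesgue_measure_itv/=; case: ifP => // _; rewrite -EFinB ltry.
  exists `|r|; split; first exact: num_real.
  by move=> M rM s _; exact: ltW.
have Jc r : \int[mu]_(s in `[a, b[) r = r * (b - a).
  rewrite Rintegral_cst//= lebesgue_measure_itv/= lte_fin.
  case: ltP => // ba; have -> : a = b by lra.
  by rewrite subrr.
rewrite -Rintegral_itv_bndo_bndc// ler_norml; apply/andP; split.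
  rewrite lerBrDr -mulNr -mulrDl -Jc; apply: le_Rintegral => //; first exact: ic.
  by move=> s /=; rewrite in_itv/= => /gc; rewrite ler_norml; lra.
rewrite lerBlDr -mulrDl -Jc; apply: le_Rintegral => //; first exact: ic.
by move=> s /=; rewrite in_itv/= => /gc; rewrite ler_norml; lra.
Qed.

Lemma integral_expR A t : 0 < A -> 0 <= t ->
  mu.-integrable `[0, t] (EFin \o (fun s => expR (A * s))) /\
  segment_integral (fun s => expR (A * s)) 0 t <= expR (A * t) / A.
Proof.
move=> A0; have cA : continuous (fun s : R => expR (A * s)).
  move=> s; apply: (@continuous_comp _ _ _ (fun s => A * s) expR).
    exact: mulrl_continuous.
  exact: continuous_expR.
have cG : continuous (fun s : R => expR (A * s) / A).
  by move=> s; apply: cvgM; [exact: cA|exact: cvg_cst].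
have dG (s : R) : is_derive s 1 (fun s : R => expR (A * s) / A) (expR (A * s)).
  apply: is_derive_eq.
  rewrite /GRing.scale/= ?mulr1 ?scaler0 ?addr0 ?add0r.
  by rewrite mulr0 add0r mulrCA mulVf ?mulr1// gt_eqF.
rewrite le_eqVlt => /predU1P[<-|t0].
  split.
    apply: continuous_compact_integrable; first exact: segment_compact.
    exact: continuous_subspaceT.
  by rewrite set_itv1 Rintegral_set1 divr_ge0 ?expR_ge0 ?ltW.
split.
  apply: continuous_compact_integrable; first exact: segment_compact.
  exact: continuous_subspaceT.
rewrite /Rintegral (@continuous_FTC2 _ _ (fun s => expR (A * s) / A))//=.
- by rewrite lerBlDr lerDl divr_ge0 ?expR_ge0 ?ltW.
- exact: continuous_subspaceT.
- split; first by move=> s _; apply: ex_derive.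
  + exact/cvg_at_right_filter/cG.
  + exact/cvg_at_left_filter/cG.
- by move=> s _; rewrite derive1E; apply: derive_val.
Qed.

(** The gain of a factor [A^-1] in the weighted norm of weight [expR (A * t)]
    is what turns the integral operator into a contraction once [A] is large. *)
Lemma integral_le_expR g A N t : 0 < A -> 0 <= t ->
  mu.-integrable `[0, t] (EFin \o g) ->
  (forall s, 0 <= s <= t -> `|g s| <= N * expR (A * s)) ->
  `|segment_integral g 0 t| <= N * (expR (A * t) / A).
Proof.
move=> A0 t0 ig gN; have [iE JE] := integral_expR A0 t0.
have N0 : 0 <= N.
  have := le_trans (normr_ge0 _) (gN 0 _); rewrite lexx t0 => /(_ isT).
  by rewrite pmulr_lge0// expR_gt0.
apply: le_trans (ler_wpM2l N0 JE).
rewrite -RintegralZl//; apply: (le_trans (le_normr_Rintegral _ ig)) => //.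
apply: le_Rintegral => //.
- exact: integrable_norm.
- rewrite (_ : _ \o _ = fun x => (N%:E * (EFin \o (fun s => expR (A * s))) x)%E)//.
  exact: integrableZl.
Qed.

End Integral.

(** * Changes of time: their effect on integrals and on the reflection term *)
Section TimeChange.
Context {R : realType}.
Implicit Types (g h x y : R -> R) (a b c d e s t r T : R) (lam : R -> R).

(** Monotonicity makes such a bijection of [[0, T]] a homeomorphism. *)
Definition time_change T lam lam' : Prop :=
  [/\ forall s, 0 <= s <= T -> 0 <= lam s <= T,
      forall s, 0 <= s <= T -> 0 <= lam' s <= T,
      forall s, 0 <= s <= T -> lam' (lam s) = s,
      forall s, 0 <= s <= T -> lam (lam' s) = s &
      forall s t, 0 <= s -> s < t -> t <= T -> lam s < lam t].

Lemma time_change_id T : time_change T id id.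
Proof. by split. Qed.

Lemma time_change_le T lam lam' s t : time_change T lam lam' ->
  0 <= s -> s <= t -> t <= T -> lam s <= lam t.
Proof.
move=> [_ _ _ _ lt] s0; rewrite le_eqVlt => /predU1P[->//|st] tT.
exact/ltW/lt.
Qed.

Lemma time_change_sym T lam lam' :
  time_change T lam lam' -> time_change T lam' lam.
Proof.
move=> tc; have [m1 m2 k1 k2 _] := tc; split => // s t s0 st tT.
have s0T : 0 <= s <= T by apply/andP; split; lra.
have t0T : 0 <= t <= T by apply/andP; split; lra.
rewrite ltNge; apply/negP => h.
have /andP[a0 aT] := m2 _ t0T; have /andP[b0 bT] := m2 _ s0T.
have := time_change_le tc a0 h bT.
by rewrite !k2// leNgt st.
Qed.

Lemma time_change0 T lam lam' : 0 <= T -> time_change T lam lam' -> lam 0 = 0.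
Proof.
move=> T0 tc; have [m1 m2 k1 k2 _] := tc.
have z : 0 <= (0 : R) <= T by rewrite lexx.
have /andP[a0 aT] := m2 _ z.
have := time_change_le tc (lexx _) a0 aT; rewrite k2// => l0.
by apply/le_anti; rewrite l0; have /andP[] := m1 _ z.
Qed.

Lemma step_approx_time_change T lam lam' e y a b : time_change T lam lam' ->
  step_approx e y a b -> 0 <= a -> b <= T ->
  step_approx e (y \o lam') (lam a) (lam b).
Proof.
move=> tc; elim=> [{}a {}b c ab yc a0 bT|{}a {}b c ab iab bc ibc a0 cT].
  apply: (@flat_piece _ _ _ _ _ c); first exact: (time_change_le tc).
  move=> s /andP[as_ sb]; have [m1 m2 k1 k2 _] := tc.
  have a0T : 0 <= a <= T by apply/andP; split; lra.
  have b0T : 0 <= b <= T by apply/andP; split; lra.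
  have /andP[? ?] := m1 _ a0T; have /andP[? ?] := m1 _ b0T.
  have [_ _ _ _ lt'] := time_change_sym tc.
  apply: yc; rewrite -(k1 a)// -(k1 b)//; apply/andP; split.
    by apply: (time_change_le (time_change_sym tc)) => //; lra.
  by apply: lt' => //; lra.
have ab' := step_approx_le ab; have bc' := step_approx_le bc.
by apply: cat_pieces (iab _ _) (ibc _ _) => //; lra.
Qed.

Lemma regulated_time_change T lam lam' y a b : time_change T lam lam' ->
  regulated y a b -> 0 <= a -> b <= T ->
  regulated (y \o lam') (lam a) (lam b).
Proof.
by move=> tc ry a0 bT e e0; apply: step_approx_time_change tc (ry e e0) _ _.
Qed.

(** On a piece where [y] is within [e] of a constant [c], both integrals are
    [c] times the length of the interval up to [e] times that length, and the two
    lengths differ by at most [2 * d].  Summing over the pieces, [C] depends on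
    the approximation but not on the change of time. *)
Lemma integral_time_change_step T y e a b : 0 < e -> regulated y 0 T ->
  step_approx e y a b -> 0 <= a -> b <= T -> exists2 C, 0 <= C &
    forall lam lam' d, time_change T lam lam' ->
      (forall s, 0 <= s <= T -> `|lam s - s| <= d) ->
      forall t, a <= t <= b ->
      `|segment_integral (y \o lam') (lam a) (lam t) - segment_integral y a t|
        <= 2 * e * (t - a) + C * d.
Proof.
move=> e0 ry.
have iy := regulated_integrable ry.
elim=> [{}a {}b c ab yc a0 bT|{}a {}b c ab iab bc ibc a0 cT].
  exists (2 * `|c| + 2 * e); first by rewrite addr_ge0// mulr_ge0// ltW.
  move=> lam lam' d tc lamd t /andP[at_ tb].
  have T0 : 0 <= T by lra.
  have t0T : 0 <= t <= T by apply/andP; split; lra.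
  have a0T : 0 <= a <= T by apply/andP; split; lra.
  have b0T : 0 <= b <= T by apply/andP; split; lra.
  have [m1 m2 k1 k2 _] := tc.
  have [m1' m2' k1' k2' lt'] := time_change_sym tc.
  have /andP[? ?] := m1 _ a0T; have /andP[? ?] := m1 _ t0T.
  have ly : regulated (y \o lam') 0 (lam T).
    rewrite -{1}(time_change0 T0 tc); exact: regulated_time_change tc ry _ _.
  have lat : lam a <= lam t by apply: (time_change_le tc); lra.
  have h1 : `|segment_integral (y \o lam') (lam a) (lam t) - c * (lam t - lam a)|
      <= e * (lam t - lam a).
    apply: integral_near_cst => //.
      apply: integrable_sub (regulated_integrable ly) _ _ => //.
      by apply: (time_change_le tc) => //; lra.
    move=> s /andP[as_ st]; apply: yc.
    have : lam' (lam a) <= lam' s.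
      by apply: (time_change_le (time_change_sym tc)) => //; lra.
    have : lam' s < lam' (lam t) by apply: lt' => //; lra.
    by rewrite !k1// => ? ?; apply/andP; split; lra.
  have h2 : `|segment_integral y a t - c * (t - a)| <= e * (t - a).
    apply: integral_near_cst => //; first by apply: integrable_sub iy _ _; lra.
    by move=> s /andP[as_ st]; apply: yc; apply/andP; split; lra.
  have da := lamd _ a0T; have dt := lamd _ t0T.
  have h3 : `|c * (lam t - lam a) - c * (t - a)| <= 2 * `|c| * d.
    rewrite -mulrBr normrM mulrAC mulrC ler_wpM2r//.
    by move: da dt; rewrite !ler_norml; lra.
  have h4 : e * (lam t - lam a) <= e * (t - a + 2 * d).
    by rewrite ler_pM2l//; move: da dt; rewrite !ler_norml; lra.
  move: h1 h2 h3 h4; rewrite !ler_norml; lra.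
have ab' := step_approx_le ab; have bc' := step_approx_le bc.
have [|C1 C10 h1] := iab a0 _; first by lra.
have [|C2 C20 h2] := ibc _ cT; first by lra.
exists (C1 + C2); first by rewrite addr_ge0.
move=> lam lam' d tc lamd t /andP[at_ tc'].
have T0 : 0 <= T by lra.
have d0 : 0 <= d by apply: le_trans (lamd 0 _) => //; rewrite lexx.
have C1d : 0 <= C1 * d by exact: mulr_ge0.
have C2d : 0 <= C2 * d by exact: mulr_ge0.
have [tb|bt] := leP t b.
  have := h1 lam lam' d tc lamd t; rewrite at_ tb => /(_ isT).
  by move=> /le_trans; apply; lra.
have b0 : 0 <= b := le_trans a0 ab'.
have t0 : 0 <= t := le_trans a0 at_.
have tT : t <= T := le_trans tc' cT.
have bT : b <= T := le_trans (ltW bt) tT.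
have ly : regulated (y \o lam') 0 (lam T).
  rewrite -{1}(time_change0 T0 tc); exact: regulated_time_change tc ry _ _.
have {}h1 := h1 lam lam' d tc lamd b _.
have {}h2 := h2 lam lam' d tc lamd t _.
have lab : lam a <= lam b by exact: (time_change_le tc).
have lbt : lam b <= lam t by apply: (time_change_le tc) => //; exact: ltW.
have ltT : lam t <= lam T by exact: (time_change_le tc).
have la0 : 0 <= lam a.
  rewrite -(time_change0 T0 tc).
  exact: (time_change_le tc _ _ (le_trans ab' bT)).
rewrite (@integral_cat _ (y \o lam') _ (lam b))//; last first.
  exact: integrable_sub (regulated_integrable ly) _ _.
rewrite (@integral_cat _ y _ b)//; [|exact: integrable_sub iy _ _|exact: ltW].
have {}h1 : `|segment_integral (y \o lam') (lam a) (lam b) - segment_integral y a b|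
        <= 2 * e * (b - a) + C1 * d by apply: h1; rewrite ab' lexx.
have {}h2 : `|segment_integral (y \o lam') (lam b) (lam t) - segment_integral y b t|
        <= 2 * e * (t - b) + C2 * d by apply: h2; rewrite tc' ltW.
clear -h1 h2; by move: h1 h2; rewrite !ler_norml; lra.
Qed.

(** A change of time need not be absolutely continuous, so there is no
    substitution formula for these integrals.  For one fixed path, step
    approximation shows nevertheless that the error is small uniformly over all
    changes of time close to the identity. *)
Lemma integral_time_change T y e : 0 <= T -> regulated y 0 T -> 0 < e ->
  exists2 d, 0 < d & forall lam lam', time_change T lam lam' ->
    (forall s, 0 <= s <= T -> `|lam s - s| <= d) ->
    forall t, 0 <= t <= T ->
    `|segment_integral (y \o lam') 0 (lam t) - segment_integral y 0 t| <= e.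
Proof.
move=> T0 ry e0; pose e' := e / (4 * (T + 1)).
have e'0 : 0 < e' by rewrite divr_gt0//; lra.
have [C C0 h] := integral_time_change_step e'0 ry (ry _ e'0) (lexx _) (lexx _).
exists (e / (2 * (C + 1))) => [|lam lam' tc lamd t t0T].
  by rewrite divr_gt0//; lra.
have {h} := h _ _ _ tc lamd _ t0T; rewrite (time_change0 T0 tc) subr0.
move=> /le_trans; apply.
have -> : e = e / 2 + e / 2 by lra.
apply: lerD.
  have : e' * (4 * (T + 1)) = e by rewrite divfK//; lra.
  have : e' * t <= e' * (T + 1) by rewrite ler_pM2l//; lra.
  lra.
rewrite mulrA ler_pdivrMr; last by lra.
have : 0 <= e * C by rewrite mulr_ge0// ltW.
lra.
Qed.

Lemma psi_ge x t s : rcll x -> 0 <= s <= t -> Num.max (- x s) 0 <= psi x t.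
Proof.
move=> rx /andP[s0 st]; apply: ub_le_sup; last first.
  by exists s => //=; rewrite in_itv/= s0.
have [M xM] := regulated_bounded (rcll_regulated rx (lexx _) (le_trans s0 st)).
exists `|M| => _ [r /= /[!in_itv]/= /xM rM <-].
rewrite ge_max normr_ge0 andbT.
by move: rM; rewrite ler_norml => /andP[? ?]; have := ler_norm M; lra.
Qed.

Lemma psi_ge0 x t : rcll x -> 0 <= t -> 0 <= psi x t.
Proof.
move=> rx t0; have := @psi_ge x t 0 rx; rewrite lexx t0 => /(_ isT).
by rewrite ge_max => /andP[].
Qed.

(** Every comparison of reflection terms below, across times, paths or changes
    of time, is an instance of this inequality between suprema. *)
Lemma psi_le x x' t t' e : rcll x' -> 0 <= t -> 0 <= t' -> 0 <= e ->
  (forall s, 0 <= s <= t -> exists2 s', 0 <= s' <= t' & x' s' <= x s + e) ->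
  psi x t <= psi x' t' + e.
Proof.
move=> rx' t0 t'0 e0 xx'; apply: ge_sup.
  by exists (Num.max (- x 0) 0), 0 => //=; rewrite in_itv/= lexx.
move=> _ [s /= /[!in_itv]/= /xx'[s' s't' xe] <-].
rewrite ge_max addr_ge0 ?psi_ge0// andbT.
by have := psi_ge rx' s't'; rewrite ge_max => /andP[]; lra.
Qed.

(** The reflection map commutes with changes of time and is 1-Lipschitz for the
    uniform norm on [[0, t]]. *)
Lemma psi_close T lam lam' x x' t e : time_change T lam lam' -> rcll x ->
  rcll x' -> 0 <= t <= T ->
  (forall s, 0 <= s <= t -> `|x' (lam s) - x s| <= e) ->
  `|psi x' (lam t) - psi x t| <= e.
Proof.
move=> tc rx rx' t0T xx'.
have [m1 m2 k1 k2 _] := tc.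
have /andP[t0 tT] := t0T; have /andP[lt0 ltT] := m1 _ t0T.
have T0 : 0 <= T by lra.
have l0 := time_change0 T0 tc.
have e0 : 0 <= e by apply: le_trans (xx' 0 _) => //; rewrite lexx.
rewrite ler_norml; apply/andP; split; last first.
  rewrite lerBlDr addrC; apply: psi_le => // s /andP[s0 st].
  have s0T : 0 <= s <= T by apply/andP; split; lra.
  have sl : lam' s <= t.
    by rewrite -(k1 t)//; apply: (time_change_le (time_change_sym tc)).
  have /andP[ls0 _] := m2 _ s0T.
  exists (lam' s); first by rewrite ls0.
  by have := xx' (lam' s); rewrite k2// ls0 sl ler_norml => /(_ isT); lra.
suff : psi x t <= psi x' (lam t) + e by lra.
apply: psi_le => // s /andP[s0 st].
have s0T : 0 <= s <= T by apply/andP; split; lra.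
exists (lam s).
  have /andP[-> _]/= := m1 _ s0T.
  by apply: (time_change_le tc).
by have := xx' s; rewrite s0 st => /(_ isT); rewrite ler_norml; lra.
Qed.

(** The running supremum moves by no more than the path does, which transfers
    the regularity of [x] to [psi x]. *)
Lemma psi_osc x s r e : rcll x -> 0 <= s -> s <= r ->
  (forall u, s <= u <= r -> `|x u - x s| <= e) -> `|psi x r - psi x s| <= e.
Proof.
move=> rx s0 sr xe; have r0 : 0 <= r by lra.
have e0 : 0 <= e by apply: le_trans (xe s _) => //; rewrite lexx.
rewrite ler_norml; apply/andP; split.
  suff : psi x s <= psi x r + 0 by lra.
  apply: psi_le => // u /andP[u0 us]; exists u; last by rewrite addr0.
  by apply/andP; split; lra.
rewrite lerBlDr addrC; apply: psi_le => // u /andP[u0 ur].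
have [us|su] := leP u s; first by exists u; [rewrite u0|lra].
exists s; first by rewrite s0 lexx.
by have := xe u; rewrite ur (ltW su) ler_norml => /(_ isT); lra.
Qed.

Lemma psi_rcll x : rcll x -> rcll (psi x).
Proof.
move=> rx t t0 e e0; have [d d0 xd] := rx t t0 e e0; exists d => //.
have H s r : 0 <= s -> s <= r -> `|s - t| < d -> `|r - t| < d ->
    same_side t s r -> `|psi x r - psi x s| <= e.
  move=> s0 sr sd rd ss; apply: psi_osc => // u /andP[su ur].
  apply: xd => //; first lra.
    by move: sd rd; rewrite !ltr_norml; lra.
  move: ss; rewrite /same_side.
  have [rt|tr] := ltP r t.
    by rewrite (le_lt_trans ur rt) (le_lt_trans sr rt).
  have [//|ts] := ltP s t; by rewrite ltNge (le_trans ts su).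
move=> s r s0 r0 sd rd ss; have [sr|rs] := leP s r.
  by rewrite distrC; apply: H.
apply: H => //; first exact: ltW.
by rewrite /same_side eq_sym.
Qed.

Lemma integral_osc E t g : rcll g -> 0 <= t ->
  osc E t (fun t => segment_integral g 0 t).
Proof.
move=> rg t0 e e0; have t10 : 0 <= t + 1 by lra.
have rg' := rcll_regulated rg (lexx _) t10.
have [M0 gM] := regulated_bounded rg'.
pose M := `|M0| + 1; have M_gt0 : 0 < M by rewrite /M ltr_wpDl.
have {}gM s : 0 <= s <= t + 1 -> `|g s| <= M.
  by move=> /gM; have := ler_norm M0; rewrite /M; lra.
exists (Num.min 1 (e / (2 * M))).
  by rewrite lt_min ltr01/= divr_gt0// mulr_gt0.
have H s r : 0 <= s -> s <= r -> `|s - t| < Num.min 1 (e / (2 * M)) ->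
   `|r - t| < Num.min 1 (e / (2 * M)) ->
   `|segment_integral g 0 r - segment_integral g 0 s| <= e.
  move=> s0 sr; rewrite !lt_min => /andP[s1 se] /andP[r1 re].
  have rt1 : r <= t + 1 by move: r1; rewrite ltr_norml; lra.
  have ig := regulated_integrable rg'.
  rewrite (@integral_cat _ g 0 s r)//; last first.
    by apply: integrable_sub ig _ _.
  rewrite addrAC subrr add0r.
  have := @integral_near_cst _ g s r 0 M; rewrite mul0r subr0 => h.
  apply: (@le_trans _ _ (M * (r - s))).
    apply: h => //; first exact: integrable_sub ig _ _.
    by move=> u /andP[su ur]; rewrite subr0; apply: gM; apply/andP; split; lra.
  have ke : e / (2 * M) * (2 * M) = e by rewrite divfK// gt_eqF// mulr_gt0.
  have : M * (r - s) <= M * (2 * (e / (2 * M))).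
    by rewrite ler_pM2l//; move: se re; rewrite !ltr_norml; lra.
  move: ke; clear; lra.
move=> s r s0 r0 sd rd _; have [sr|rs] := leP s r.
  by rewrite distrC; apply: H.
by apply: H => //; exact: ltW.
Qed.

End TimeChange.

(** * Geometric convergence *)
Section Geometric.
Context {R : realType}.

Lemma le_geometric (x a c : R) : (forall m, x <= a + c / 2 ^+ m) -> x <= a.
Proof.
move=> xa; apply/ler_addgt0Pr => e e0.
have c0 : 0 < `|c| + 1 by rewrite ltr_wpDl.
have [m _ me] := near_infty_natSinv_expn_lt (PosNum (divr_gt0 e0 c0)).
have {me} := me m (leqnn m); rewrite div1r /= => me.
apply: (le_trans (xa m)); rewrite lerD2l.
have k0 : 0 < (2 ^+ m)^-1 :> R by rewrite invr_gt0 exprn_gt0.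
apply: (@le_trans _ _ ((`|c| + 1) * (2 ^+ m)^-1)).
  by rewrite ler_pM2r//; have := ler_norm c; lra.
by rewrite mulrC -ler_pdivlMr// ltW.
Qed.

Lemma cvg_geometric_cauchy (a : nat -> R) C :
  (forall m, `|a m.+1 - a m| <= C / 2 ^+ m) ->
  forall m, `|lim (a n @[n --> \oo]) - a m| <= 2 * C / 2 ^+ m.
Proof.
move=> aC.
have C0 : 0 <= C.
  by have := le_trans (normr_ge0 _) (aC 0); rewrite expr0 divr1.
have step m n : `|a (m + n)%N - a m| <= 2 * C / 2 ^+ m.
  suff : `|a (m + n)%N - a m| <= 2 * C / 2 ^+ m - 2 * C / 2 ^+ (m + n).
    have : 0 <= 2 * C / 2 ^+ (m + n) by rewrite divr_ge0 ?exprn_ge0// mulr_ge0.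
    lra.
  elim: n => [|n ih]; first by rewrite addn0 !subrr normr0.
  have := aC (m + n)%N; rewrite addnS exprS invfM; move: ih.
  by rewrite !ler_norml; lra.
have acvg : cvg (a n @[n --> \oo]).
  apply/cauchy_cvgP/cauchy_exP => e e0.
  have c0 : 0 < 2 * C + 1 by lra.
  have [m _ me] := near_infty_natSinv_expn_lt (PosNum (divr_gt0 e0 c0)).
  have {me} := me m (leqnn m); rewrite div1r /= => me.
  exists (a m); exists m => // n /= mn; rewrite /ball/= distrC -(subnKC mn).
  apply: (le_lt_trans (step m (n - m)%N)).
  move: me; rewrite ltr_pdivlMr//.
  have : 0 < (2 ^+ m)^-1 :> R by rewrite invr_gt0 exprn_gt0.
  lra.
move=> m; apply/ler_addgt0Pr => e e0.
have /cvgrPdist_le/(_ _ e0)[n _ an] := acvg.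
have := an (m + n)%N (leq_addl _ _); have := step m n.
by rewrite !ler_norml; lra.
Qed.

End Geometric.

(** * The fixed-point operator and its contraction estimate *)
Section Network.
Context {R : realType} {J K : nat} (eta : 'I_K -> R)
  (p : 'M[R]_(J, K)) (q : 'M[R]_(K, J)) (eta_gt0 : forall k, 0 < eta k)
  (p_stochastic : stochastic p) (q_stochastic : stochastic q).
Implicit Types (xi : R -> 'rV[R]_J) (zeta y : R -> 'rV[R]_K).

Lemma stochastic_le1 m n (A : 'M[R]_(m, n)) i j : stochastic A -> A i j <= 1.
Proof.
move=> [A0 A1]; rewrite -(A1 i) (bigD1 j)//= lerDl.
exact: sumr_ge0.
Qed.

Definition rclls k (x : R -> 'rV[R]_k) := forall l, rcll (fun t => x t ord0 l).

(** Since the entries of [q] are at most 1, [total_rate] bounds both the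
    coefficients [q l j * eta l], summed over [l], and each [eta k]. *)
Definition total_rate := \sum_l eta l.
Local Notation H := total_rate.

(** Lipschitz constant of [picard] with respect to the inputs and to the
    integrated path: [1 + H] comes from the net input, and is counted once more
    for each of the [J] reflection terms. *)
Definition picard_lip := (1 + H) * (1 + J%:R).
Local Notation B := picard_lip.

(** The right-hand side of the equation defining the third component, as an
    operator on paths. *)
Definition picard xi zeta y : R -> 'rV[R]_K := fun t => \row_k
  (zeta t ord0 k - eta k * segment_integral (fun s => y s ord0 k) 0 t
   - \sum_(j < J) p j k * psi (net_input eta q xi y j) t).

Lemma total_rate_ge0 : 0 <= H.
Proof. by apply: sumr_ge0 => l _; exact: ltW. Qed.

Lemma eta_le_total k : eta k <= H.
Proof.
by rewrite /H (bigD1 k)//= lerDl sumr_ge0// => l _; exact: ltW.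
Qed.

Lemma picard_lip_ge1 : 1 <= B.
Proof.
have := total_rate_ge0; have : 0 <= J%:R :> R by [].
rewrite /B => j0 h0; have := mulr_ge0 h0 j0; lra.
Qed.

Lemma net_osc E t xi y j : 0 <= t -> osc E t (fun t => xi t ord0 j) -> rclls y ->
  osc E t (net_input eta q xi y j).
Proof.
move=> t0 rxi ry; apply: oscD => //; apply: osc_sum => l; apply: oscZ.
exact: integral_osc.
Qed.

Lemma net_rcll xi y j : rclls xi -> rclls y -> rcll (net_input eta q xi y j).
Proof. by move=> rxi ry t t0; apply: net_osc => //; exact: rxi. Qed.

Lemma picard_rcll xi zeta y : rclls xi -> rclls zeta -> rclls y ->
  rclls (picard xi zeta y).
Proof.
move=> rxi rzeta ry k t t0.
rewrite (_ : (fun t => _) = fun t => zeta t ord0 k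
    + (- eta k) * segment_integral (fun s => y s ord0 k) 0 t
    + -1 * (\sum_(j < J) p j k * psi (net_input eta q xi y j) t)); last first.
  by apply/funext => s; rewrite mxE !mulNr mul1r.
apply: oscD; first apply: oscD.
- exact: rzeta.
- by apply: oscZ; exact: integral_osc.
- apply: oscZ; apply: osc_sum => j; apply: oscZ.
  by apply: psi_rcll => //; exact: net_rcll.
Qed.

(** The difference splits into the effect of the change of time on the fixed
    path [g], which is at most [rho], and the integral of
    [g' - g \o lam'], which the weighted bound on [g' \o lam - g] controls.  Each
    of the two shifts of time by at most [d] costs a factor [expR (A * d)]; their
    product is at most 2. *)
Lemma integral_close T lam lam' d rho A N (g g' : R -> R) :
  time_change T lam lam' ->
  (forall s, 0 <= s <= T -> `|lam s - s| <= d) ->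
  0 < A -> expR (2 * A * d) <= 2 -> rcll g -> rcll g' ->
  (forall s, 0 <= s <= T ->
    `|segment_integral (g \o lam') 0 (lam s) - segment_integral g 0 s| <= rho) ->
  (forall s, 0 <= s <= T -> `|g' (lam s) - g s| <= N * expR (A * s)) ->
  forall s, 0 <= s <= T ->
   `|segment_integral g' 0 (lam s) - segment_integral g 0 s| <= rho + 2 * N * (expR (A * s) / A).
Proof.
move=> tc lamd A0 Ad rg rg' tcrho gN s s0T.
have /andP[s0 sT] := s0T; have T0 : 0 <= T := le_trans s0 sT.
have [m1 m2 k1 k2 _] := tc.
have /andP[ls0 lsT] := m1 _ s0T.
have N0 : 0 <= N.
  have := le_trans (normr_ge0 _) (gN _ s0T).
  by rewrite pmulr_lge0// expR_gt0.
have rgl : regulated (g \o lam') 0 (lam s).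
  rewrite -{1}(time_change0 T0 tc); apply: regulated_time_change tc _ _ _ => //.
  exact: rcll_regulated.
have i1 := regulated_integrable rgl.
have i2 := regulated_integrable (rcll_regulated rg' (lexx _) ls0).
have -> : segment_integral g' 0 (lam s) - segment_integral g 0 s =
  segment_integral (fun r => g' r - (g \o lam') r) 0 (lam s) +
   (segment_integral (g \o lam') 0 (lam s) - segment_integral g 0 s).
  by rewrite RintegralB// addrA subrK.
rewrite addrC; apply: le_trans (ler_normD _ _) _; apply: lerD.
  exact: tcrho.
apply: le_trans (integral_le_expR (N := N * expR (A * d)) A0 ls0 _ _) _.
- exact: (integrableB _ i2 i1).
- move=> r /andP[r0 rs].
  have r0T : 0 <= r <= T by rewrite r0 (le_trans rs lsT).
  have := gN _ (m2 _ r0T); rewrite k2// => /le_trans; apply.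
  rewrite -mulrA ler_wpM2l// -expRD ler_expR -mulrDr ler_pM2l//.
  have := lamd _ (m2 _ r0T); rewrite k2// ler_norml; lra.
- rewrite -[2 * N * _]mulrA [2 * _]mulrCA -mulrA ler_wpM2l// !mulrA.
  rewrite ler_pM2r ?invr_gt0// -expRD.
  apply: (@le_trans _ _ (expR (2 * A * d) * expR (A * s))).
    rewrite -expRD ler_expR; have := lamd _ s0T.
    have : lam s - s <= d -> A * (lam s - s) <= A * d by rewrite ler_pM2l.
    by rewrite ler_norml => h /andP[_ /h]; lra.
  by rewrite ler_wpM2r// expR_ge0.
Qed.

Lemma net_close T lam lam' rho b xi xi' y y' j s :
  time_change T lam lam' -> 0 <= s <= T ->
  `|xi' (lam s) ord0 j - xi s ord0 j| <= rho ->
  (forall l, `|segment_integral (fun u => y' u ord0 l) 0 (lam s)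
             - segment_integral (fun u => y u ord0 l) 0 s| <= b) ->
  `|net_input eta q xi' y' j (lam s) - net_input eta q xi y j s| <= rho + H * b.
Proof.
move=> tc s0T xir yb; rewrite /net_input.
rewrite opprD addrACA -sumrB.
apply: le_trans (ler_normD _ _) _; apply: lerD => //.
apply: le_trans (ler_norm_sum _ _ _) _; rewrite /H mulr_suml.
apply: ler_sum => l _; rewrite -mulrBr normrM.
rewrite ger0_norm ?mulr_ge0 ?(ltW (eta_gt0 _)) ?q_stochastic.1//.
apply: ler_pM => //; first by rewrite mulr_ge0 ?(ltW (eta_gt0 _)) ?q_stochastic.1.
by rewrite ler_piMl ?(ltW (eta_gt0 _))// stochastic_le1.
Qed.

(** The weight [expR (4 * B * t)] is chosen so that the Lipschitz constant [B],
    the factor 2 lost to the shifts of time and the gain [(4 * B)^-1] of the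
    integral multiply to [2^-1]: one application of the operator halves the
    weighted distance, up to an error proportional to [rho]. *)
Lemma picard_close T lam lam' d rho N xi xi' zeta zeta' y y' :
  time_change T lam lam' ->
  (forall s, 0 <= s <= T -> `|lam s - s| <= d) ->
  expR (2 * (4 * B) * d) <= 2 ->
  rclls xi -> rclls xi' -> rclls y -> rclls y' ->
  (forall j s, 0 <= s <= T -> `|xi' (lam s) ord0 j - xi s ord0 j| <= rho) ->
  (forall k s, 0 <= s <= T -> `|zeta' (lam s) ord0 k - zeta s ord0 k| <= rho) ->
  (forall l s, 0 <= s <= T ->
    `|segment_integral ((fun u => y u ord0 l) \o lam') 0 (lam s)
      - segment_integral (fun u => y u ord0 l) 0 s| <= rho) ->
  (forall l s, 0 <= s <= T ->
    `|y' (lam s) ord0 l - y s ord0 l| <= N * expR (4 * B * s)) ->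
  forall k s, 0 <= s <= T ->
   `|picard xi' zeta' y' (lam s) ord0 k - picard xi zeta y s ord0 k|
     <= (B * rho + N / 2) * expR (4 * B * s).
Proof.
move=> tc lamd Bd rxi rxi' ry ry' xir zetar tcr yN k s s0T.
have B1 := picard_lip_ge1; have H0 := total_rate_ge0.
have A0 : 0 < 4 * B by lra.
have rho0 : 0 <= rho by exact: le_trans (zetar k s s0T).
have N0 : 0 <= N.
  have := le_trans (normr_ge0 _) (yN k _ s0T).
  by rewrite pmulr_lge0// expR_gt0.
have iy l u : 0 <= u <= T -> `|segment_integral (fun u => y' u ord0 l) 0 (lam u)
      - segment_integral (fun u => y u ord0 l) 0 u|
    <= rho + 2 * N * (expR (4 * B * u) / (4 * B)).
  by move: u; apply: (integral_close tc lamd A0 Bd (ry l) (ry' l) (tcr l) (yN l)).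
pose b := rho + 2 * N * (expR (4 * B * s) / (4 * B)).
have rhob : rho <= b.
  rewrite lerDl; apply: mulr_ge0; first exact: mulr_ge0.
  by rewrite divr_ge0 ?expR_ge0// ltW.
have /andP[s0 sT] := s0T.
have psib j : `|psi (net_input eta q xi' y' j) (lam s)
     - psi (net_input eta q xi y j) s| <= b + H * b.
  apply: (psi_close tc) => //; [exact: net_rcll|exact: net_rcll|].
  move=> u /andP[u0 us]; have u0T : 0 <= u <= T by rewrite u0 (le_trans us sT).
  apply: le_trans (net_close tc u0T (b := b) (xir _ _ u0T) _) _.
    move=> l; apply: (le_trans (iy l u u0T)); rewrite lerD2l.
    rewrite ler_wpM2l ?mulr_ge0// ler_wpM2r ?invr_ge0 ?(ltW A0)//.
    by rewrite ler_expR ler_pM2l.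
  by rewrite lerD2r.
have sumb : `|\sum_(j < J) p j k * psi (net_input eta q xi' y' j) (lam s)
    - \sum_(j < J) p j k * psi (net_input eta q xi y j) s| <= J%:R * (b + H * b).
  rewrite -sumrB; apply: le_trans (ler_norm_sum _ _ _) _.
  rewrite -[J in J%:R]card_ord mulr_natl -sumr_const; apply: ler_sum => j _.
  rewrite -mulrBr normrM ger0_norm ?p_stochastic.1//.
  apply: le_trans (psib j); rewrite ler_piMl// stochastic_le1//.
have etab : `|eta k * segment_integral (fun u => y' u ord0 k) 0 (lam s)
   - eta k * segment_integral (fun u => y u ord0 k) 0 s| <= H * b.
  rewrite -mulrBr normrM ger0_norm ?(ltW (eta_gt0 _))//.
  by apply: ler_pM => //; [exact: ltW|exact: eta_le_total|exact: iy].
have Bb : b + H * b + J%:R * (b + H * b) = B * b by rewrite /B; ring.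
apply: (@le_trans _ _ (B * b)).
  rewrite -Bb !mxE; have := zetar k s s0T.
  by move: etab sumb rhob; clear; rewrite !ler_norml; lra.
have E1 : 1 <= expR (4 * B * s).
  have : 0 <= 4 * B * s by rewrite mulr_ge0// ltW.
  by have := expR_ge1Dx (4 * B * s); lra.
have Br : B * rho * 1 <= B * rho * expR (4 * B * s).
  by rewrite ler_wpM2l// mulr_ge0//; lra.
rewrite /b mulrDr.
have -> : B * (2 * N * (expR (4 * B * s) / (4 * B))) = N / 2 * expR (4 * B * s).
  by field; lra.
lra.
Qed.

End Network.

(** * Existence and stability of the fixed point *)
Section Solution.
Context {R : realType} {J K : nat} (eta : 'I_K -> R)
  (p : 'M[R]_(J, K)) (q : 'M[R]_(K, J)) (eta_gt0 : forall k, 0 < eta k)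
  (p_stochastic : stochastic p) (q_stochastic : stochastic q).
Implicit Types (xi : R -> 'rV[R]_J) (zeta y : R -> 'rV[R]_K).

Local Notation H := (total_rate eta).
Local Notation B := (@picard_lip R J K eta).

Lemma rcll_uniform_limit (y : R -> R) :
  (forall T e, 0 <= T -> 0 < e -> exists2 g, rcll g &
    forall s, 0 <= s <= T -> `|y s - g s| <= e) -> rcll y.
Proof.
move=> yg t t0 e e0; have e30 : 0 < e / 3 by rewrite divr_gt0.
have [g rg gy] := yg (t + 1) (e / 3) (addr_ge0 t0 ler01) e30.
have [d d0 gd] := rg t t0 _ e30.
exists (Num.min d 1) => [|s r s0 r0]; first by rewrite lt_min d0 ltr01.
rewrite !lt_min => /andP[sd s1] /andP[rd r1] ss.
have h1 := gd s r s0 r0 sd rd ss.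
have h2 : `|y s - g s| <= e / 3.
  by apply: gy; move: s1; rewrite s0/= ltr_norml; lra.
have h3 : `|y r - g r| <= e / 3.
  by apply: gy; move: r1; rewrite r0/= ltr_norml; lra.
by move: h1 h2 h3; rewrite !ler_norml; lra.
Qed.

Lemma rclls_bounded k (x : R -> 'rV[R]_k) T : rclls x -> 0 <= T ->
  exists2 M, 0 <= M & forall l s, 0 <= s <= T -> `|x s ord0 l| <= M.
Proof.
move=> rx T0; have Ml l : {M | forall s, 0 <= s <= T -> `|x s ord0 l| <= M}.
  exact/cid/regulated_bounded/rcll_regulated.
exists (\sum_l `|sval (Ml l)|) => [|l s s0T]; first exact: sumr_ge0.
apply: le_trans (svalP (Ml l) s s0T) _; apply: le_trans (ler_norm _) _.
by rewrite (bigD1 l)//= lerDl sumr_ge0.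
Qed.

Lemma expR_weight_ge1 t : 0 <= t -> 1 <= expR (4 * B * t).
Proof.
move=> t0; have B1 : 1 <= B by exact: picard_lip_ge1.
have B0 : 0 <= 4 * B by lra.
have : 0 <= 4 * B * t by exact: mulr_ge0.
by have := expR_ge1Dx (4 * B * t); lra.
Qed.

(** Specializing to the identity change of time and equal inputs removes the
    error term. *)
Lemma picard_contract T N xi zeta y y' :
  rclls xi -> rclls y -> rclls y' ->
  (forall l s, 0 <= s <= T ->
    `|y' s ord0 l - y s ord0 l| <= N * expR (4 * B * s)) ->
  forall k s, 0 <= s <= T ->
   `|picard eta p q xi zeta y' s ord0 k - picard eta p q xi zeta y s ord0 k|
     <= N / 2 * expR (4 * B * s).
Proof.
move=> rxi ry ry' yN k s s0T.
have := picard_close eta_gt0 p_stochastic q_stochastic (d := 0) (rho := 0)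
  (N := N) (zeta := zeta) (zeta' := zeta) (time_change_id T) _ _ rxi rxi ry ry'.
rewrite mulr0 expR0 mulr0 add0r; apply=> //.
- by move=> u _; rewrite subrr normr0.
- by lra.
- by move=> j u _; rewrite subrr normr0.
- by move=> j u _; rewrite subrr normr0.
- by move=> l u _; rewrite subrr normr0.
Qed.

(** Picard iteration: successive iterates approach each other geometrically on
    every [[0, T]], in a weighted norm whose weight is independent of [T], so the
    pointwise limit is one path on the whole half line, and convergence to it
    is uniform on compact intervals. *)
Lemma picard_fixpoint xi zeta : rclls xi -> rclls zeta ->
  exists2 y, rclls y &
    forall k t, 0 <= t -> y t ord0 k = picard eta p q xi zeta y t ord0 k.
Proof.
move=> rxi rzeta; pose F := picard eta p q xi zeta.
pose ys n := iter n F (fun=> 0).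
have rys n : rclls (ys n).
  elim: n => [|n ih]; last exact: picard_rcll.
  by move=> l t _; rewrite (_ : (fun t => _) = fun=> 0);
    [exact: osc_cst|apply/funext => s; rewrite mxE].
have ysC T : 0 <= T -> exists2 N, 0 <= N & forall n k s, 0 <= s <= T ->
    `|ys n.+1 s ord0 k - ys n s ord0 k| <= N / 2 ^+ n * expR (4 * B * s).
  move=> T0; have [N N0 yN] := rclls_bounded (rys 1%N) T0.
  exists N => // n; elim: n => [|n ih] k s s0T.
    have -> : ys 0%N s ord0 k = 0 by rewrite mxE.
    rewrite expr0 divr1 subr0.
    apply: le_trans (yN _ _ s0T) _; rewrite ler_peMr// expR_weight_ge1//.
    by case/andP: s0T.
  rewrite exprSr invfM mulrA.
  exact: (picard_contract zeta rxi (rys n) (rys n.+1) ih).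
pose y s : 'rV[R]_K := \row_k lim (ys n s ord0 k @[n --> \oo]).
have yC T : 0 <= T -> exists2 N, 0 <= N & forall n k s, 0 <= s <= T ->
    `|y s ord0 k - ys n s ord0 k| <= N / 2 ^+ n * expR (4 * B * s).
  move=> T0; have [N N0 yN] := ysC T T0.
  exists (2 * N) => [|n k s s0T]; first by rewrite mulr_ge0.
  rewrite mxE mulrAC -[2 * N * _]mulrA.
  apply: (@cvg_geometric_cauchy _ (fun n => ys n s ord0 k)) => m.
  by rewrite mulrAC; exact: yN.
have ry : rclls y.
  move=> k; apply: rcll_uniform_limit => T e T0 e0.
  have [N N0 yN] := yC T T0.
  have E0 : 0 < expR (4 * B * T) by exact: expR_gt0.
  have c0 : 0 < (N + 1) * expR (4 * B * T) by rewrite mulr_gt0//; lra.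
  have [n _ ne] := near_infty_natSinv_expn_lt (PosNum (divr_gt0 e0 c0)).
  have {ne} := ne n (leqnn n); rewrite div1r /= ltr_pdivlMr// => ne.
  exists (fun s => ys n s ord0 k) => [|s s0T]; first exact: rys.
  apply: le_trans (yN _ _ _ s0T) _; apply/ltW/(le_lt_trans _ ne).
  have k0 : 0 <= (2 ^+ n)^-1 :> R by rewrite invr_ge0 exprn_ge0.
  have Es : expR (4 * B * s) <= expR (4 * B * T).
    have B1 : 1 <= B by exact: picard_lip_ge1.
    by rewrite ler_expR ler_pM2l//; [case/andP: s0T|lra].
  rewrite mulrAC [leRHS]mulrC ler_wpM2r//.
  by apply: ler_pM; rewrite ?expR_ge0//; lra.
exists y => // k t t0; apply/eqP.
rewrite -subr_eq0 -normr_eq0 eq_le normr_ge0 andbT.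
have [N N0 yN] := yC t t0.
have tt : 0 <= t <= t by rewrite t0 lexx.
apply: (@le_geometric _ _ _ (N * expR (4 * B * t))) => n; rewrite add0r.
have h1 := yN n.+1 k t tt.
have h2 := picard_contract zeta rxi (rys n) ry (yN n) k tt.
have -> : N * expR (4 * B * t) / 2 ^+ n = N / 2 ^+ n.+1 * expR (4 * B * t)
   + N / 2 ^+ n / 2 * expR (4 * B * t).
  by rewrite exprS invfM; lra.
apply: (le_trans (ler_distD (ys n.+1 t ord0 k) _ _)); apply: lerD h1 _.
by rewrite distrC; exact: h2.
Qed.

(** Both paths are fixed points, so [picard_close] maps any bound on their
    weighted distance to its half plus [B * rho].  Starting from a crude bound and
    iterating, only the limit [2 * B * rho] remains; this replaces Gronwall's
    inequality. *)
Lemma fixpoint_close T lam lam' d rho xi xi' zeta zeta' y y' : 0 <= T ->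
  time_change T lam lam' ->
  (forall s, 0 <= s <= T -> `|lam s - s| <= d) ->
  expR (2 * (4 * B) * d) <= 2 ->
  rclls xi -> rclls xi' -> rclls y -> rclls y' ->
  (forall j s, 0 <= s <= T -> `|xi' (lam s) ord0 j - xi s ord0 j| <= rho) ->
  (forall k s, 0 <= s <= T -> `|zeta' (lam s) ord0 k - zeta s ord0 k| <= rho) ->
  (forall l s, 0 <= s <= T ->
    `|segment_integral ((fun u => y u ord0 l) \o lam') 0 (lam s)
      - segment_integral (fun u => y u ord0 l) 0 s| <= rho) ->
  (forall k t, 0 <= t -> y t ord0 k = picard eta p q xi zeta y t ord0 k) ->
  (forall k t, 0 <= t -> y' t ord0 k = picard eta p q xi' zeta' y' t ord0 k) ->
  forall l s, 0 <= s <= T ->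
    `|y' (lam s) ord0 l - y s ord0 l| <= 2 * B * rho * expR (4 * B * s).
Proof.
move=> T0 tc lamd Bd rxi rxi' ry ry' xir zetar tcr yfix y'fix.
have [M M0 yM] := rclls_bounded ry T0.
have [M' M'0 y'M] := rclls_bounded ry' T0.
have [m1 m2 k1 k2 _] := tc.
suff yN n : forall l s, 0 <= s <= T -> `|y' (lam s) ord0 l - y s ord0 l|
    <= (2 * B * rho + (M + M') / 2 ^+ n) * expR (4 * B * s).
  move=> l s s0T.
  apply: (@le_geometric _ _ _ ((M + M') * expR (4 * B * s))) => n.
  by apply: le_trans (yN n l s s0T) _; rewrite mulrDl mulrAC [X in _ + X]mulrAC.
elim: n => [|n ih] l s s0T.
  (* the crude bound M + M' suffices at first: the weight is at least 1 *)
  have rho0 : 0 <= rho by exact: le_trans (tcr l s s0T).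
  rewrite expr0 divr1; apply: (@le_trans _ _ (M + M')).
    by have := yM l _ s0T; have := y'M l _ (m1 _ s0T); rewrite !ler_norml; lra.
  have B1 : 1 <= B by exact: picard_lip_ge1.
  have c0 : 0 <= 2 * B * rho by apply: mulr_ge0 => //; lra.
  apply: (@le_trans _ _ (2 * B * rho + (M + M'))); first by rewrite lerDr.
  rewrite ler_peMr ?expR_weight_ge1//; last by case/andP: s0T.
  by apply: addr_ge0 => //; exact: addr_ge0.
have [s0 sT] := andP s0T.
have /andP[ls0 _] := m1 _ s0T.
rewrite yfix// y'fix//.
have := picard_close eta_gt0 p_stochastic q_stochastic tc lamd Bd rxi rxi' ry ry'
  xir zetar tcr ih l s0T.
move=> /le_trans; apply; rewrite ler_wpM2r ?expR_ge0// exprSr invfM.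
by lra.
Qed.

End Solution.

(** * Componentwise and pointwise forms of the path topology *)
Section PathTopology.
Context {R : realType}.
Implicit Types (g : R -> R) (t T e : R).

Lemma cvg_rowP (I : Type) (F : set_system I) {FF : Filter F} k
    (x : I -> 'rV[R]_k) (v : 'rV[R]_k) :
  x @ F --> v <-> forall l, x s ord0 l @[s --> F] --> v ord0 l.
Proof.
split=> [xv l|xv].
  apply/cvg_ballP => e e0; have /cvg_ballP/(_ e e0) := xv.
  by apply: filterS => s [_ /(_ ord0 l)].
apply/cvg_ballP => e e0.
have : \forall s \near F, forall l, ball (v ord0 l) e (x s ord0 l).
  by apply: filter_forall => l; have /cvg_ballP/(_ e e0) := xv l.
apply: filterS => s vs; rewrite /ball/=; split=> // i j; rewrite ord1.
exact: vs.
Qed.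

(** Completeness of the reals turns the Cauchy form of left limits into their
    existence. *)
Lemma rcllP g : rcll g <->
  (forall t, 0 <= t -> g @ t^'+ --> g t) /\
  (forall t, 0 < t -> exists l : R, g @ t^'- --> l).
Proof.
split=> [rg|[gr gl] t t0 e e0].
  split=> t t0.
    apply/cvgrPdist_le => e e0; have [d d0 gd] := rg t t0 e e0.
    apply/nbhs_ballP; exists d => //= s; rewrite /ball/= => ts t_s.
    apply: gd => //; rewrite ?subrr ?normr0 1?distrC//.
    - by rewrite ltW// (le_lt_trans t0).
    - by rewrite /same_side ltxx ltNge (ltW t_s).
  exists (lim (g @ t^'-)); apply/cauchy_cvgP/cauchy_exP => e e0.
  have e20 : 0 < e / 2 by rewrite divr_gt0.
  have [d d0 gd] := rg t (ltW t0) _ e20.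
  (* a reference point just before t, at a nonnegative time *)
  pose r := t - Num.min d t / 2.
  have m0 : 0 < Num.min d t by rewrite lt_min d0.
  have md : Num.min d t <= d by rewrite ge_min lexx.
  have mt : Num.min d t <= t by rewrite ge_min lexx orbT.
  have rd : `|r - t| < d by rewrite ltr_norml /r; apply/andP; split; lra.
  have r0 : 0 <= r by rewrite /r; lra.
  have rt : r < t by rewrite /r; lra.
  exists (g r); apply/nbhs_ballP; exists (Num.min d t) => //= s.
  rewrite /ball/= distrC => ts s_t.
  apply: (@le_lt_trans _ _ (e / 2)); last by rewrite ltr_pdivrMr//; lra.
  apply: gd => //.
  - by move: ts; rewrite ltr_norml; lra.
  - exact: lt_le_trans ts md.
  - by rewrite /same_side rt s_t.
have e20 : 0 < e / 2 by rewrite divr_gt0.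
have /cvgrPdist_le/(_ _ e20)/nbhs_ballP[d1 /= d10 gd1] := gr t t0.
have [d2 d20 gd2] : exists2 d, 0 < d & forall s r, 0 <= s -> 0 <= r ->
    s < t -> r < t -> `|s - t| < d -> `|r - t| < d -> `|g s - g r| <= e.
  move: t0; rewrite le_eqVlt => /predU1P[<-|t0].
    by exists 1 => // s r s0 _; rewrite ltNge s0.
  have [l /cvgrPdist_le/(_ _ e20)/nbhs_ballP[d /= d0 gd]] := gl t t0.
  exists d => // s r _ _ st rt sd rd.
  have := gd s; rewrite /ball/= distrC => /(_ sd st).
  have := gd r; rewrite /ball/= distrC => /(_ rd rt).
  by rewrite !ler_norml; lra.
exists (Num.min d1 d2) => [|s r s0 r0]; first by rewrite lt_min d10.
rewrite !lt_min => /andP[sd1 sd2] /andP[rd1 rd2].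
have g1 u : `|u - t| < d1 -> t <= u -> `|g t - g u| <= e / 2.
  move=> ud; rewrite le_eqVlt => /predU1P[<-|tu].
    by rewrite subrr normr0 ltW.
  by apply: gd1 => //; rewrite /ball/= distrC.
rewrite /same_side; have [st|ts] := ltP s t; have [rt|tr] := ltP r t => // _.
  exact: gd2.
by have := g1 s sd1 ts; have := g1 r rd1 tr; rewrite !ler_norml; lra.
Qed.

Lemma cadlagP k (x : R -> 'rV[R]_k) : cadlag x <-> rclls x.
Proof.
split=> [[xr xl] l|rx].
  apply/rcllP; split=> t t0; first exact: ((cvg_rowP _ _).1 (xr t t0) l).
  by have [v xv] := xl t t0; exists (v ord0 l); exact: ((cvg_rowP _ _).1 xv l).
split=> t t0.
  by apply/cvg_rowP => l; have /rcllP[xr _] := rx l; exact: xr.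
have xl l : {v : R | x s ord0 l @[s --> t^'-] --> v}.
  by apply/cid; have /rcllP[_] := rx l; apply.
exists (\row_l sval (xl l)); apply/cvg_rowP => l.
by rewrite mxE; exact: (svalP (xl l)).
Qed.

Definition any_side : rel R := fun _ _ => true.

Lemma continuous_atP k (x : R -> 'rV[R]_k) T : 0 < T ->
  {for T, continuous x} <-> forall l, osc any_side T (fun t => x t ord0 l).
Proof.
move=> T0; rewrite /prop_for /continuous_at; split.
  move=> /(cvg_rowP _ _).1 xT l e e0; have e20 : 0 < e / 2 by rewrite divr_gt0.
  have /cvgrPdist_le/(_ _ e20)/nbhs_ballP[d /= d0 xd] := xT l.
  exists d => // s r _ _ sd rd _.
  have := xd s; rewrite /ball/= distrC => /(_ sd).
  have := xd r; rewrite /ball/= distrC => /(_ rd).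
  by rewrite !ler_norml; lra.
move=> xT; apply/cvg_rowP => l; apply/cvgrPdist_le => e e0.
have [d d0 xd] := xT l e e0.
apply/nbhs_ballP; exists (Num.min d T) => /= [|s]; first by rewrite lt_min d0.
rewrite /ball/= distrC lt_min => /andP[sd sT].
apply: xd => //; rewrite ?subrr ?normr0// ?ltW//.
by move: sT; rewrite ltr_norml; lra.
Qed.

Lemma incr_homeo_time_change T lam : incr_homeo T lam ->
  exists lam', time_change T lam lam'.
Proof.
move=> [lt _ [lam' [s1 s2 k1 k2 _]]]; exists lam'; split.
- by move=> s sT; have := s1 s; rewrite /= !in_itv/= => /(_ sT).
- by move=> s sT; have := s2 s; rewrite /= !in_itv/= => /(_ sT).
- by move=> s sT; apply: k1; rewrite in_itv.
- by move=> s sT; apply: k2; rewrite in_itv.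
- move=> s t s0 st tT; apply: lt => //; rewrite in_itv/=.
    by rewrite s0 ltW// (lt_le_trans st).
  by rewrite tT ltW// (le_lt_trans s0).
Qed.

Lemma unorm_leP k T (x : R -> 'rV[R]_k) e : 0 <= e ->
  (unorm T x <= e%:E)%E <-> forall l s, 0 <= s <= T -> `|x s ord0 l| <= e.
Proof.
move=> e0; split=> [xe l s sT|xe].
  rewrite -lee_fin; apply: le_trans xe.
  apply: le_trans (le_bigmax _ _ l); apply: ereal_sup_ubound.
  by exists s => //=; rewrite in_itv.
apply: bigmax_le; first by rewrite lee_fin.
move=> l _; apply: ge_ereal_sup => _ [s /= sT <-]; rewrite lee_fin.
by apply: xe; move: sT; rewrite in_itv.
Qed.

Lemma J1_dist_lt k T (x y : R -> 'rV[R]_k) e : 0 <= e ->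
  (J1_dist T x y < e%:E)%E -> exists lam lam', [/\ incr_homeo T lam,
    time_change T lam lam',
    forall s, 0 <= s <= T -> `|lam s - s| <= e &
    forall l s, 0 <= s <= T -> `|x (lam s) ord0 l - y s ord0 l| <= e].
Proof.
move=> e0 /ereal_inf_lt[_ [lam /= hlam <-]]; rewrite gt_max => /andP[xe lame].
have [lam' tc] := incr_homeo_time_change hlam; exists lam, lam'; split => //.
  move=> s sT; rewrite -lee_fin; apply: le_trans (ltW lame).
  by apply: ereal_sup_ubound; exists s => //=; rewrite in_itv.
move=> l s sT; have /(unorm_leP _ _ e0)/(_ l s sT) := ltW xe.
by rewrite !mxE.
Qed.

Lemma J1_dist_le k T (x y : R -> 'rV[R]_k) lam e : 0 <= e -> incr_homeo T lam ->
  (forall s, 0 <= s <= T -> `|lam s - s| <= e) ->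
  (forall l s, 0 <= s <= T -> `|x (lam s) ord0 l - y s ord0 l| <= e) ->
  (J1_dist T x y <= e%:E)%E.
Proof.
move=> e0 hlam lame xye.
apply: (@le_trans _ _ (maxe (unorm T (fun t => x (lam t) - y t))
    (ereal_sup [set (`|lam t - t|)%:E | t in `[0, T]]))).
  by apply: ereal_inf_lbound; exists lam.
rewrite ge_max; apply/andP; split.
  by apply/unorm_leP => // l s sT; rewrite !mxE; exact: xye.
apply: ge_ereal_sup => _ [s /= sT <-]; rewrite lee_fin; apply: lame.
by move: sT; rewrite in_itv.
Qed.

Lemma J1_dist_ge0 k T (x y : R -> 'rV[R]_k) : (0 <= J1_dist T x y)%E.
Proof.
apply: le_ereal_inf_tmp => _ [lam _ <-]; rewrite le_max; apply/orP; left.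
exact: bigmax_ge_id.
Qed.

Lemma cvg_ge0_ereal0P (u : nat -> \bar R) : (forall n, 0 <= u n)%E ->
  u n @[n --> \oo] --> 0%E <->
  forall e, 0 < e -> \forall n \near \oo, (u n < e%:E)%E.
Proof.
move=> u0; split=> [/fine_cvgP[ufin /cvgrPdist_lt ucv] e e0|ue].
  have := ucv e e0; apply: filterS2 ufin => n un.
  by rewrite sub0r normrN /= ger0_norm ?fine_ge0// -lte_fin fineK.
apply/fine_cvgP; split.
  apply: filterS (ue 1 ltr01) => n un.
  by rewrite ge0_fin_numE// (lt_trans un)// ltry.
apply/cvgrPdist_lt => e e0; apply: filterS (ue e e0) => n un.
rewrite sub0r normrN /= ger0_norm ?fine_ge0// -lte_fin fineK//.
by rewrite ge0_fin_numE// (lt_trans un)// ltry.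
Qed.

End PathTopology.

(** * Continuity of the network map *)
Section Continuity.
Context {R : realType} {J K : nat} (mu : 'I_J -> R) (eta : 'I_K -> R)
  (p : 'M[R]_(J, K)) (q : 'M[R]_(K, J))
  (mu_gt0 : forall j, 0 < mu j) (eta_gt0 : forall k, 0 < eta k)
  (p_stochastic : stochastic p) (q_stochastic : stochastic q).
Implicit Types (x : R -> 'rV[R]_(J + K)).

Local Notation H := (total_rate eta).
Local Notation B := (@picard_lip R J K eta).
Local Notation xi x := (fun t => lsubmx (x t)).
Local Notation zeta x := (fun t => rsubmx (x t)).
Local Notation y x := (f3 eta p q x).
Local Notation net x := (net_input eta q (xi x) (y x)).
Local Notation F := (f mu eta p q).

Lemma lsubmx_rclls x : rclls x -> rclls (xi x).
Proof.
move=> rx l; rewrite (_ : (fun t => _) = fun t => x t ord0 (lshift K l)).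
  exact: rx.
by apply/funext => t; rewrite mxE.
Qed.

Lemma rsubmx_rclls x : rclls x -> rclls (zeta x).
Proof.
move=> rx l; rewrite (_ : (fun t => _) = fun t => x t ord0 (rshift J l)).
  exact: rx.
by apply/funext => t; rewrite mxE.
Qed.

Lemma f3_fixpoint x : rclls x -> rclls (y x) /\
  forall k t, 0 <= t ->
    y x t ord0 k = picard eta p q (xi x) (zeta x) (y x) t ord0 k.
Proof.
move=> rx.
have [z rz zfix] := picard_fixpoint eta_gt0 p_stochastic q_stochastic
  (lsubmx_rclls rx) (rsubmx_rclls rx).
suff [cy yfix] : is_solution eta p q (xi x) (zeta x) (y x).
  by split=> [|k t t0]; [exact/cadlagP|rewrite yfix// [RHS]mxE].
apply: (@getPex _ [set y | is_solution eta p q (xi x) (zeta x) y]).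
exists z; split=> [|k t t0]; first exact/cadlagP.
by rewrite zfix// mxE.
Qed.

Lemma f_phiE x j t : F x t ord0 (lshift K (lshift J j)) = phi (net x j) t.
Proof. by rewrite /f !row_mxEl mxE. Qed.

Lemma f_psiE x j t :
  F x t ord0 (lshift K (rshift J j)) = (mu j)^-1 * psi (net x j) t.
Proof. by rewrite /f row_mxEl row_mxEr mxE. Qed.

Lemma f_yE x k t : F x t ord0 (rshift (J + J) k) = y x t ord0 k.
Proof. by rewrite /f row_mxEr. Qed.

Lemma f_coordP (P : 'I_(J + J + K) -> Prop) :
  (forall j, P (lshift K (lshift J j))) ->
  (forall j, P (lshift K (rshift J j))) ->
  (forall k, P (rshift (J + J) k)) -> forall l, P l.
Proof.
move=> P1 P2 P3 l; case: (split_ordP l) => [i ->|k ->//].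
by case: (split_ordP i) => j ->.
Qed.

Lemma f_rclls x : rclls x -> rclls (F x).
Proof.
move=> rx; have [ry _] := f3_fixpoint rx.
have rnet j : rcll (net x j) by apply: net_rcll => //; exact: lsubmx_rclls.
elim/f_coordP => [j|j|k] t t0.
- apply: osc_ext (oscD (rnet j t t0) (psi_rcll (rnet j) t0)) => s _.
  by rewrite f_phiE.
- apply: osc_ext (oscZ (mu j)^-1 (psi_rcll (rnet j) t0)) => s _.
  by rewrite f_psiE.
- by apply: osc_ext (ry k t t0) => s _; rewrite f_yE.
Qed.

(** The map loses no jump of its argument: the net input is [phi - psi], and
    subtracting from it, or adding to the third component, terms that are
    continuous at [T] recovers [x].  Hence continuity points of the image are
    continuity points of [x], the only horizons at which convergence of the
    arguments is known. *)
Lemma f_continuity_point x T : 0 <= T -> rclls x ->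
  (forall l, osc any_side T (fun t => F x t ord0 l)) ->
  forall l, osc any_side T (fun t => x t ord0 l).
Proof.
move=> T0 rx cF; have [ry yfix] := f3_fixpoint rx.
have cpsi j : osc any_side T (psi (net x j)).
  apply: osc_ext (oscZ (mu j) (cF (lshift K (rshift J j)))) => s _.
  by rewrite f_psiE mulrA divff ?mul1r// gt_eqF.
have cnet j : osc any_side T (net x j).
  apply: osc_ext (oscD (cF (lshift K (lshift J j))) (oscZ (-1) (cpsi j))) => s _.
  by rewrite f_phiE /phi; lra.
have cy k : osc any_side T (fun t => y x t ord0 k).
  by apply: osc_ext (cF (rshift (J + J) k)) => s _; rewrite f_yE.
have cint k : osc any_side T (fun t => segment_integral (fun s => y x s ord0 k) 0 t).
  exact: integral_osc.
move=> l; case: (split_ordP l) => [j ->|k ->].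
  have h := oscD (cnet j) (oscZ (-1) (osc_sum (enum 'I_K)
    (fun l => oscZ (q l j * eta l) (cint l)))).
  apply: osc_ext h => s _; rewrite big_enum/= mulN1r /net_input addrK.
  by rewrite mxE.
have h := oscD (oscD (cy k) (oscZ (eta k) (cint k)))
  (osc_sum (enum 'I_J) (fun j => oscZ (p j k) (cpsi j))).
apply: osc_ext h => s s0; rewrite big_enum/= yfix// 2!mxE.
by rewrite -addrA -addrA [X in _ + X]addrCA; lra.
Qed.

(** The first term bounds the error of the third component.  In the second one,
    the last factor bounds the error of the net inputs, hence of [psi]; it is
    doubled by [phi] and multiplied by [(mu j)^-1] in the second component. *)
Definition lipschitz_cst T :=
  2 * B * expR (4 * B * T)
  + (2 + \sum_j (mu j)^-1) * (1 + H * (1 + expR (4 * B * T))).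

(** With respect to a common change of time close to the identity, the map is
    Lipschitz at [x], where the perturbation [rho] also has to dominate the error
    that the change of time makes in the integrals of the solution at [x]. *)
Lemma f_close T lam lam' rho x x' : 0 <= T -> 0 <= rho ->
  time_change T lam lam' ->
  (forall s, 0 <= s <= T -> `|lam s - s| <= ln 2 / (8 * B)) ->
  rclls x -> rclls x' ->
  (forall l s, 0 <= s <= T -> `|x' (lam s) ord0 l - x s ord0 l| <= rho) ->
  (forall l s, 0 <= s <= T ->
    `|segment_integral ((fun u => y x u ord0 l) \o lam') 0 (lam s)
      - segment_integral (fun u => y x u ord0 l) 0 s| <= rho) ->
  forall l s, 0 <= s <= T ->
    `|F x' (lam s) ord0 l - F x s ord0 l| <= lipschitz_cst T * rho.
Proof.
move=> T0 rho0 tc lamd rx rx' xr tcr l s s0T.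
have [ry yfix] := f3_fixpoint rx; have [ry' y'fix] := f3_fixpoint rx'.
have rxi := lsubmx_rclls rx; have rxi' := lsubmx_rclls rx'.
have B1 : 1 <= B by exact: picard_lip_ge1.
have H0 : 0 <= H by exact: total_rate_ge0.
have xir j u : 0 <= u <= T ->
    `|lsubmx (x' (lam u)) ord0 j - lsubmx (x u) ord0 j| <= rho.
  by move=> uT; rewrite !mxE; exact: xr.
have zetar k u : 0 <= u <= T ->
    `|rsubmx (x' (lam u)) ord0 k - rsubmx (x u) ord0 k| <= rho.
  by move=> uT; rewrite !mxE; exact: xr.
have A0 : 0 < 4 * B by lra.
have Bd : expR (2 * (4 * B) * (ln 2 / (8 * B))) <= 2.
  rewrite (_ : 2 * _ * _ = ln 2); first by rewrite lnK// posrE.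
  by field; lra.
have yr := fixpoint_close eta_gt0 p_stochastic q_stochastic T0 tc lamd Bd
  rxi rxi' ry ry' xir zetar tcr yfix y'fix.
pose E := expR (4 * B * T).
have E0 : 0 < E by exact: expR_gt0.
have expE u : 0 <= u <= T -> expR (4 * B * u) <= E.
  by move=> /andP[_ uT]; rewrite ler_expR ler_pM2l.
pose W := 1 + H * (1 + E).
have W0 : 0 <= W by rewrite /W addr_ge0// mulr_ge0//; lra.
have netr j u : 0 <= u <= T -> `|net x' j (lam u) - net x j u| <= W * rho.
  move=> uT; have -> : W * rho = rho + H * (rho + rho * E) by rewrite /W; lra.
  apply: (net_close eta_gt0 q_stochastic tc uT); first exact: xir.
  move=> k.
  have := integral_close tc lamd A0 Bd (ry k) (ry' k) (tcr k) (yr k) uT.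
  move=> /le_trans; apply; rewrite lerD2l.
  have -> : 2 * (2 * B * rho) * (expR (4 * B * u) / (4 * B))
      = rho * expR (4 * B * u) by field; lra.
  by rewrite ler_wpM2l// expE.
have psir j : `|psi (net x' j) (lam s) - psi (net x j) s| <= W * rho.
  apply: (psi_close tc) => //; [exact: net_rcll|exact: net_rcll|].
  move=> u /andP[u0 us]; apply: netr; rewrite u0 (le_trans us)//.
  by case/andP: s0T.
have mu0 : 0 <= \sum_j (mu j)^-1.
  by apply: sumr_ge0 => j _; rewrite invr_ge0 ltW.
have Wr0 : 0 <= W * rho by exact: mulr_ge0.
have mWr0 : 0 <= (\sum_j (mu j)^-1) * (W * rho) by exact: mulr_ge0.
have BE0 : 0 <= 2 * B * rho * E.
  by apply: mulr_ge0; [apply: mulr_ge0 => //; lra|exact: ltW].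
have -> : lipschitz_cst T * rho = 2 * B * rho * E + 2 * (W * rho)
    + (\sum_j (mu j)^-1) * (W * rho) by rewrite /lipschitz_cst -/E -/W; ring.
elim/f_coordP: l => [j|j|k].
- rewrite !f_phiE /phi opprD addrACA.
  apply: (le_trans (ler_normD _ _)).
  apply: (le_trans (lerD (netr j s s0T) (psir j))).
  lra.
- rewrite !f_psiE -mulrBr normrM gtr0_norm ?invr_gt0//.
  apply: (@le_trans _ _ ((\sum_j (mu j)^-1) * (W * rho))); last first.
    lra.
  apply: ler_pM => //; first by rewrite invr_ge0 ltW.
  rewrite (bigD1 j)//= lerDl; apply: sumr_ge0 => i _; by rewrite invr_ge0 ltW.
- rewrite !f_yE; apply: le_trans (yr k s s0T) _.
  have : 2 * B * rho * expR (4 * B * s) <= 2 * B * rho * E.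
    rewrite ler_wpM2l ?expE//; apply: mulr_ge0 => //; lra.
  lra.
Qed.

Lemma J1_continuous_f : J1_continuous F.
Proof.
split=> [x /cadlagP rx|u x cu cx ux T T0 FxT]; first exact/cadlagP/f_rclls.
have ru n : rclls (u n) by apply/cadlagP.
move/cadlagP: cx => rx; have [ry _] := f3_fixpoint rx.
have TT : 0 <= T := ltW T0.
have xT : {for T, continuous x}.
  apply/(continuous_atP x T0)/f_continuity_point => //.
  exact/(continuous_atP (F x) T0).
have /(cvg_ge0_ereal0P (fun n => J1_dist_ge0 T (u n) x)) uxT := ux T T0 xT.
apply/(cvg_ge0_ereal0P (fun n => J1_dist_ge0 T (F (u n)) (F x))) => e e0.
have B1 : 1 <= B by exact: picard_lip_ge1.
have H0 : 0 <= H by exact: total_rate_ge0.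
have mod0 : 0 <= lipschitz_cst T.
  have E0 : 0 < expR (4 * B * T) by exact: expR_gt0.
  have m0 : 0 <= \sum_j (mu j)^-1.
    by apply: sumr_ge0 => j _; rewrite invr_ge0 ltW.
  apply: addr_ge0; first by apply: mulr_ge0; [lra|exact: ltW].
  apply: mulr_ge0; first lra.
  by apply: addr_ge0 => //; apply: mulr_ge0 => //; lra.
(* rho has to keep both the paths and the change of time within e / 2,
   hence the term 1 next to the Lipschitz constant *)
pose rho := e / (2 * (lipschitz_cst T + 1)).
have rho0 : 0 < rho by rewrite divr_gt0// mulr_gt0//; lra.
have modrho : lipschitz_cst T * rho + rho = e / 2.
  by rewrite /rho; field; rewrite gt_eqF//; lra.
have modrho0 : 0 <= lipschitz_cst T * rho by rewrite mulr_ge0// ltW.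
have dl l : {d | 0 < d /\ forall lam lam', time_change T lam lam' ->
    (forall s, 0 <= s <= T -> `|lam s - s| <= d) ->
    forall t, 0 <= t <= T ->
    `|segment_integral ((fun u => y x u ord0 l) \o lam') 0 (lam t)
      - segment_integral (fun u => y x u ord0 l) 0 t| <= rho}.
  have ryl := rcll_regulated (ry l) (lexx _) TT.
  by apply/cid; have [d d0 h] := integral_time_change TT ryl rho0; exists d.
(* a single d serves all components of the solution at x *)
pose d := \big[Num.min/Num.min rho (ln 2 / (8 * B))]_l sval (dl l).
have d0 : 0 < d.
  apply/bigmin_gtP; split=> [|l _]; last exact: (svalP (dl l)).1.
  rewrite lt_min rho0 divr_gt0 ?ln_gt0//; lra.
have dle l : d <= sval (dl l) by exact: bigmin_le.
have : d <= Num.min rho (ln 2 / (8 * B)) by exact: bigmin_le_id.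
rewrite le_min => /andP[dr dB].
apply: filterS (uxT d d0) => n.
move=> /(J1_dist_lt (ltW d0))[lam [lam' [hlam tc lamd ur]]].
apply: (@le_lt_trans _ _ (e / 2)%:E); last by rewrite lte_fin; lra.
have fr := f_close TT (ltW rho0) tc
  (fun s sT => le_trans (lamd s sT) dB) rx (ru n)
  (fun l s sT => le_trans (ur l s sT) dr)
  (fun l => (svalP (dl l)).2 lam lam' tc
     (fun r rT => le_trans (lamd r rT) (dle l))).
apply: (J1_dist_le _ hlam); first lra.
- by move=> s sT; apply: le_trans (lamd s sT) _; lra.
- by move=> l s sT; apply: le_trans (fr l s sT) _; lra.
Qed.

End Continuity.

Theorem proposition2 (R : realType) (J K : nat)
    (mu : 'I_J -> R) (eta : 'I_K -> R)
    (p : 'M[R]_(J, K)) (q : 'M[R]_(K, J))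
    (mu_gt0 : forall j, 0 < mu j) (eta_gt0 : forall k, 0 < eta k)
    (p_stochastic : stochastic p) (q_stochastic : stochastic q) :
  J1_continuous (f mu eta p q).
Proof. exact: J1_continuous_f. Qed.
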